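(* Let $h:\mathbb{Z}_{\ge0}\to\mathbb{Z}_{\ge0}$ be nondecreasing and satisfy condition (a): for all $z,z'\in\mathbb{Z}_{\ge0}$ and every positive integer $i$, if $\lfloor z/2^i\rfloor=\lfloor z'/2^i\rfloor$ then $\lfloor h(z)/2^{i-1}\rfloor=\lfloor h(z')/2^{i-1}\rfloor$. Consider the impartial game whose positions are triples $\{x,y,z\}$ of nonnegative integers with $y\le h(z)$ and whose moves are $move_h(\{x,y,z\})=\{\{u,y,z\}:u<x\}\cup\{\{x,v,z\}:v<y\}\cup\{\{x,\min(y,h(w)),w\}:w<z\}$, under normal play (a player with no move, i.e. facing $\{0,0,0\}$, loses). Then the set of $\mathcal{P}$-positions is $A_h=\{\{x,y,z\}: y\le h(z),\ x\oplus y\oplus z=0\}$ and the set of $\mathcal{N}$-positions is $B_h=\{\{x,y,z\}: y\le h(z),\ x\oplus y\oplus z\neq 0\}$.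
   Context: $\oplus$ denotes nim-sum (bitwise XOR). This game models the disjunctive sum of a single strip of chocolate of length $x$ to the left of the bitter square and the chocolate bar $CB(h,y,z)$ to the right. A $\mathcal{P}$-position is one from which the previous player can force a win; an $\mathcal{N}$-position is one from which the next player can force a win. *)

(* Defs.v *)
From Stdlib Require Import Arith.

(** Stdlib [nat] arithmetic; nim-sum is [Nat.lxor], bitwise exclusive or. *)

(** For an impartial game given by its move relation ([move p q]: the player to
    move may go from [p] to [q]) under normal play, [N_position p] says that
    the next player can force a win from [p], and [P_position p] that the
    previous player can.  Terminal positions are [P_position]s: there the
    premise of [P_intro] is vacuous.  As the least fixed point is taken, a
    forced win is reached after finitely many moves. *)
Inductive N_position {T : Type} (move : T -> T -> Prop) (p : T) : Prop :=
| N_intro (q : T) : move p q -> P_position move q -> N_position move p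
with P_position {T : Type} (move : T -> T -> Prop) (p : T) : Prop :=
| P_intro : (forall q : T, move p q -> N_position move q) -> P_position move p.

Definition nondecreasing (h : nat -> nat) : Prop :=
  forall z z' : nat, z <= z' -> h z <= h z'.

Definition condition_a (h : nat -> nat) : Prop :=
  forall z z' i : nat, 0 < i ->
    z / 2 ^ i = z' / 2 ^ i -> h z / 2 ^ (i - 1) = h z' / 2 ^ (i - 1).

Record position (h : nat -> nat) : Type := Position {
  pos_x : nat;
  pos_y : nat;
  pos_z : nat;
  pos_y_le : pos_y <= h pos_z
}.

Arguments Position {h} pos_x pos_y pos_z pos_y_le.
Arguments pos_x {h} p.
Arguments pos_y {h} p.
Arguments pos_z {h} p.
Arguments pos_y_le {h} p.

Definition coords {h : nat -> nat} (p : position h) : nat * nat * nat :=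
  (pos_x p, pos_y p, pos_z p).

(** The options of a triple, as a set of triples. *)
Definition move_triple (h : nat -> nat) (t t' : nat * nat * nat) : Prop :=
  let '(x, y, z) := t in
  (exists u, u < x /\ t' = (u, y, z)) \/
  (exists v, v < y /\ t' = (x, v, z)) \/
  (exists w, w < z /\ t' = (x, Nat.min y (h w), w)).

Definition move_h {h : nat -> nat} (p q : position h) : Prop :=
  move_triple h (coords p) (coords q).

(** Requiring options to be positions discards nothing: every triple in
    [move_triple h (coords p)] is a position. *)
Lemma move_triple_position (h : nat -> nat) (p : position h)
    (t : nat * nat * nat) :
  move_triple h (coords p) t -> exists q : position h, coords q = t.
Proof.
destruct p as [x y z Hy]; simpl.
intros [[u [_ ->]] | [[v [Hv ->]] | [w [_ ->]]]].
- exists (Position u y z Hy); reflexivity.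
- assert (Hv' : v <= h z) by (apply Nat.lt_le_incl, Nat.lt_le_trans with y; assumption).
  exists (Position x v z Hv'); reflexivity.
- exists (Position x (Nat.min y (h w)) w (Nat.le_min_r y (h w))); reflexivity.
Qed.

Definition nim_sum {h : nat -> nat} (p : position h) : nat :=
  Nat.lxor (Nat.lxor (pos_x p) (pos_y p)) (pos_z p).

Definition A_h (h : nat -> nat) (p : position h) : Prop := nim_sum p = 0.

Definition B_h (h : nat -> nat) (p : position h) : Prop := nim_sum p <> 0.

(* Main.v *)
Require Import Defs.
From Stdlib Require Import Arith.
From Stdlib Require Import Bool Lia Wellfounded.

(** The zero positions of [nim_sum] form the kernel of the game.  Since
    [y <= h z], the second coordinate is [f z] for [f w := min y (h w)], and a
    move [z -> w] just replaces [(f z, z)] by [(f w, w)].  By condition (a) the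
    bits of [f w] from position [i] on are determined by the bits of [w] from
    position [i + 1] on.  Hence at the top bit where [w] and [z] differ, [f w]
    and [f z] agree, so the nim-sum changes.  Conversely, the bits of a [w]
    with [x], [f w], [w] of nim-sum zero can be chosen one by one from the top
    down. *)

Lemma div_pow2_eq_testbit (a b i : nat) :
  a / 2 ^ i = b / 2 ^ i <->
  (forall m, i <= m -> Nat.testbit a m = Nat.testbit b m).
Proof.
rewrite <- !Nat.shiftr_div_pow2; split.
- intros H m Hm.
  replace m with ((m - i) + i) by lia.
  now rewrite <- !Nat.shiftr_spec', H.
- intros H; apply Nat.bits_inj; intros m.
  rewrite !Nat.shiftr_spec'; apply H; lia.
Qed.

(** If [b <= a], then [b / 2 ^ j <= a / 2 ^ j]; but these quotients have equal halves, the first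
    being odd and the second even. *)
Lemma lt_of_testbit (a b j : nat) :
  (forall m, j < m -> Nat.testbit a m = Nat.testbit b m) ->
  Nat.testbit a j = false -> Nat.testbit b j = true -> a < b.
Proof.
intros Habove Ha Hb.
apply Nat.lt_nge; intros Hle.
apply (Nat.Div0.div_le_mono _ _ (2 ^ j)) in Hle.
assert (Heq : a / 2 ^ S j = b / 2 ^ S j)
  by (apply div_pow2_eq_testbit; intros m Hm; apply Habove; lia).
rewrite Nat.pow_succ_r', (Nat.mul_comm 2), <- !Nat.Div0.div_div in Heq.
rewrite Nat.testbit_eqb in Ha, Hb.
apply Nat.eqb_neq in Ha; apply Nat.eqb_eq in Hb.
pose proof (Nat.div_mod_eq (a / 2 ^ j) 2).
pose proof (Nat.div_mod_eq (b / 2 ^ j) 2).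
pose proof (Nat.mod_upper_bound (a / 2 ^ j) 2).
lia.
Qed.

Lemma top_bit (s : nat) : s <> 0 ->
  exists j, Nat.testbit s j = true /\
            forall m, j < m -> Nat.testbit s m = false.
Proof.
intros Hs; exists (Nat.log2 s); split.
- now apply Nat.bit_log2.
- intros m Hm; now apply Nat.bits_above_log2.
Qed.

Lemma lxor_lt_top_bit (a s j : nat) :
  Nat.testbit s j = true -> (forall m, j < m -> Nat.testbit s m = false) ->
  Nat.testbit a j = true -> Nat.lxor a s < a.
Proof.
intros Hj Habove Ha; apply (lt_of_testbit _ _ j).
- intros m Hm; now rewrite Nat.lxor_spec, (Habove m Hm), xorb_false_r.
- now rewrite Nat.lxor_spec, Ha, Hj.
- exact Ha.
Qed.

(** Condition (a) in terms of bits, with [i + 1] in place of its positive [i]. *)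
Definition delays_bits (f : nat -> nat) : Prop :=
  forall w w' i : nat,
    (forall m, i < m -> Nat.testbit w m = Nat.testbit w' m) ->
    forall m, i <= m -> Nat.testbit (f w) m = Nat.testbit (f w') m.

(** Division by [2 ^ i] is monotone, hence commutes with [Nat.min], so capping [h] at the constant
    [y] preserves the property. *)
Lemma delays_bits_min (h : nat -> nat) (y : nat) :
  condition_a h -> delays_bits (fun w => Nat.min y (h w)).
Proof.
intros Ha w w' i Hw; apply div_pow2_eq_testbit.
assert (Hh : h w / 2 ^ i = h w' / 2 ^ i).
{ replace i with (S i - 1) by lia.
  apply Ha; [lia |].
  now apply div_pow2_eq_testbit. }
assert (Hmin : forall b, Nat.min y b / 2 ^ i = Nat.min (y / 2 ^ i) (b / 2 ^ i)).
{ intros b; symmetry.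
  apply (Nat.min_mono (fun n => n / 2 ^ i)); [now intros ? ? -> |].
  intros m n Hmn; now apply Nat.Div0.div_le_mono. }
now rewrite !Hmin, Hh.
Qed.

Lemma delays_bits_lxor_inj (f : nat -> nat) (w z : nat) :
  delays_bits f -> Nat.lxor (f w) w = Nat.lxor (f z) z -> w = z.
Proof.
intros Hf Heq.
destruct (Nat.eq_dec (Nat.lxor w z) 0) as [H0 | Hs];
  [now apply Nat.lxor_eq | exfalso].
destruct (top_bit _ Hs) as [j [Hj Habove]].
assert (Hfj : Nat.testbit (f w) j = Nat.testbit (f z) j).
{ apply (Hf w z j); [| lia].
  intros m Hm; apply Habove in Hm; rewrite Nat.lxor_spec in Hm.
  now apply xorb_eq. }
apply (f_equal (fun n => Nat.testbit n j)) in Heq.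
rewrite !Nat.lxor_spec, Hfj in Heq.
rewrite Nat.lxor_spec in Hj.
now destruct (Nat.testbit (f z) j), (Nat.testbit w j), (Nat.testbit z j).
Qed.

(** Induction on [k] with [z] general: the step corrects bit [k] of [z] and then applies the
    hypothesis to the corrected number. *)
Lemma exists_lxor_low_bits (f : nat -> nat) (x : nat) : delays_bits f ->
  forall k z : nat, exists w : nat,
    (forall m, k <= m -> Nat.testbit w m = Nat.testbit z m) /\
    (forall m, m < k -> Nat.testbit (Nat.lxor (f w) w) m = Nat.testbit x m).
Proof.
intros Hf k; induction k as [| k IH]; intros z.
{ exists z; split; [reflexivity | lia]. }
(* Bit [k] of [f z] does not depend on bit [k] of [z], which may therefore be
   changed to make the sum right at [k]. *)
assert (Hz' : exists z',
  (forall m, k < m -> Nat.testbit z' m = Nat.testbit z m) /\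
  Nat.testbit z' k = xorb (Nat.testbit x k) (Nat.testbit (f z) k)).
{ destruct (xorb (Nat.testbit x k) (Nat.testbit (f z) k)).
  - exists (Nat.setbit z k); split.
    + intros m Hm; apply Nat.setbit_neq; lia.
    + apply Nat.setbit_eq.
  - exists (Nat.clearbit z k); split.
    + intros m Hm; apply Nat.clearbit_neq; lia.
    + apply Nat.clearbit_eq. }
destruct Hz' as [z' [Habove Hk]].
destruct (IH z') as [w [Hw Hlow]].
assert (Hwz : forall m, k < m -> Nat.testbit w m = Nat.testbit z m).
{ intros m Hm; rewrite Hw by lia; now apply Habove. }
exists w; split; [exact Hwz |].
intros m Hm; destruct (Nat.eq_dec m k) as [-> | Hne]; [| apply Hlow; lia].
rewrite Nat.lxor_spec, (Hw k), Hk by lia.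
rewrite (Hf w z k Hwz k) by lia.
now destruct (Nat.testbit x k), (Nat.testbit (f z) k).
Qed.

(** Supplies the winning move in the third coordinate: the bits of [z] above [j] are kept, and those
    from [j] down are chosen anew. *)
Lemma exists_lt_lxor (f : nat -> nat) (x z j : nat) : delays_bits f ->
  let s := Nat.lxor (Nat.lxor x (f z)) z in
  Nat.testbit s j = true -> (forall m, j < m -> Nat.testbit s m = false) ->
  Nat.testbit z j = true ->
  exists w, w < z /\ Nat.lxor (f w) w = x.
Proof.
intros Hf s Hj Habove Hz.
destruct (exists_lxor_low_bits f x Hf (S j) z) as [w [Hw Hlow]].
assert (Hfw : forall m, j <= m -> Nat.testbit (f w) m = Nat.testbit (f z) m)
  by (apply Hf; exact Hw).
exists w; split.
- apply (lt_of_testbit _ _ j); [exact Hw | | exact Hz].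
  (* As [s] and [z] both have bit [j] set, [x] and [f z] agree there, and so does [f w]. The choice
     of [w] thus forces its bit [j] to be 0. *)
  specialize (Hlow j (Nat.lt_succ_diag_r j)).
  unfold s in Hj; rewrite !Nat.lxor_spec, Hz in Hj.
  rewrite Nat.lxor_spec, Hfw in Hlow by lia.
  now destruct (Nat.testbit w j), (Nat.testbit x j), (Nat.testbit (f z) j).
- apply Nat.bits_inj; intros m.
  destruct (le_lt_dec m j) as [Hm | Hm]; [apply Hlow; lia |].
  (* Above [j] the sum is already zero, and neither [w] nor [f w] has changed there. *)
  specialize (Habove m Hm).
  unfold s in Habove; rewrite !Nat.lxor_spec in Habove.
  rewrite Nat.lxor_spec, Hw, Hfw by lia.
  now destruct (Nat.testbit x m), (Nat.testbit (f z) m), (Nat.testbit z m).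
Qed.

(** By induction along moves: from [K] every option lies outside [K] and is winning for the next
    player; from outside, some option lies in [K] and is losing. *)
Lemma kernel_positions {T : Type} (move : T -> T -> Prop) (K : T -> Prop) :
  well_founded (fun q p => move p q) ->
  (forall p, K p \/ ~ K p) ->
  (forall p q, K p -> move p q -> ~ K q) ->
  (forall p, ~ K p -> exists q, move p q /\ K q) ->
  forall p, (P_position move p <-> K p) /\ (N_position move p <-> ~ K p).
Proof.
intros Hwf Hdec Hstable Habsorb p.
induction p as [p IH] using (well_founded_ind Hwf).
split; split.
- intros [HP]; destruct (Hdec p) as [| HK]; [assumption | exfalso].
  destruct (Habsorb p HK) as [q [Hm HKq]].
  now apply (proj1 (proj2 (IH q Hm)) (HP q Hm)).
- intros HK; constructor; intros q Hm.
  apply (IH q Hm); now apply (Hstable p).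
- intros [q Hm HPq] HK.
  now apply (Hstable p q HK Hm), (IH q Hm).
- intros HK; destruct (Habsorb p HK) as [q [Hm HKq]].
  exists q; [exact Hm | now apply (IH q Hm)].
Qed.

Lemma well_founded_move_h (h : nat -> nat) :
  well_founded (fun q p : position h => move_h p q).
Proof.
apply (wf_incl _ _ (ltof _ (fun p => pos_x p + pos_y p + pos_z p)));
  [| apply well_founded_ltof].
intros q p; unfold move_h, coords, ltof; simpl.
intros [[u [Hu E]] | [[v [Hv E]] | [w [Hw E]]]];
  injection E as -> -> ->; lia.
Qed.

Lemma nim_sum_zero_move (h : nat -> nat) (p q : position h) : condition_a h ->
  nim_sum p = 0 -> move_h p q -> nim_sum q <> 0.
Proof.
intros Ha; destruct p as [x y z Hy], q as [x' y' z' Hy'].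
unfold move_h, coords, nim_sum; simpl; intros Hp Hm Hq.
rewrite Nat.lxor_assoc in Hp, Hq; apply Nat.lxor_eq in Hp, Hq.
destruct Hm as [[u [Hu E]] | [[v [Hv E]] | [w [Hw E]]]];
  injection E as -> -> ->.
- lia.
- assert (v = y); [| lia].
  (* Both [y] and [v] have nim-sum [x] with [z]; adding [z] once more cancels it. *)
  rewrite Hp in Hq; apply (f_equal (fun n => Nat.lxor n z)) in Hq.
  now rewrite !Nat.lxor_assoc, Nat.lxor_nilpotent, !Nat.lxor_0_r in Hq.
- assert (w = z); [| lia].
  apply (delays_bits_lxor_inj _ w z (delays_bits_min h y Ha)).
  rewrite (Nat.min_l y (h z) Hy); congruence.
Qed.

(** As in Nim, the top bit of the nim-sum is set in some coordinate, and that one can be lowered to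
    make the sum zero. *)
Lemma nim_sum_nonzero_move (h : nat -> nat) (p : position h) : condition_a h ->
  nim_sum p <> 0 -> exists q, move_h p q /\ nim_sum q = 0.
Proof.
intros Ha Hp.
enough (Ht : exists x y z, move_triple h (coords p) (x, y, z) /\
                           Nat.lxor (Nat.lxor x y) z = 0).
{ destruct Ht as [x [y [z [Hm H0]]]].
  destruct (move_triple_position h p _ Hm) as [q Hq].
  exists q; split; [unfold move_h; now rewrite Hq |].
  unfold coords in Hq; injection Hq as <- <- <-; exact H0. }
destruct (top_bit _ Hp) as [j [Hj Habove]].
destruct p as [x y z Hy]; unfold nim_sum, coords in *; simpl in *.
set (s := Nat.lxor (Nat.lxor x y) z) in *.
destruct (Nat.testbit x j) eqn:Hx.
(* [Nat.lxor x s] is the nim-sum of [y] and [z]. *)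
{ exists (Nat.lxor x s), y, z; split.
  - left; exists (Nat.lxor x s); split; [now apply (lxor_lt_top_bit x s j) | reflexivity].
  - rewrite (Nat.lxor_comm x s), !Nat.lxor_assoc, <- (Nat.lxor_assoc x y z).
    apply Nat.lxor_nilpotent. }
destruct (Nat.testbit y j) eqn:Hyj.
{ exists x, (Nat.lxor y s), z; split.
  - right; left; exists (Nat.lxor y s); split;
      [now apply (lxor_lt_top_bit y s j) | reflexivity].
  - rewrite <- Nat.lxor_assoc, Nat.lxor_assoc, (Nat.lxor_comm s z), <- Nat.lxor_assoc.
    apply Nat.lxor_nilpotent. }
assert (Hz : Nat.testbit z j = true).
{ unfold s in Hj; now rewrite !Nat.lxor_spec, Hx, Hyj in Hj. }
(* At [z] this function takes the value [y], because [y <= h z], so the sum in the lemma is [s]. *)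
destruct (exists_lt_lxor (fun w => Nat.min y (h w)) x z j) as [w [Hw Hx']];
  try rewrite (Nat.min_l y (h z) Hy); try assumption.
{ now apply delays_bits_min. }
exists x, (Nat.min y (h w)), w; split.
- right; right; exists w; split; [exact Hw | reflexivity].
- rewrite Nat.lxor_assoc, Hx'; apply Nat.lxor_nilpotent.
Qed.

Theorem mainTheorem3 (h : nat -> nat)
    (h_nondecreasing : nondecreasing h) (h_a : condition_a h) :
  (forall p : position h, P_position move_h p <-> A_h h p) /\
  (forall p : position h, N_position move_h p <-> B_h h p).
Proof.
assert (H : forall p : position h,
  (P_position move_h p <-> A_h h p) /\ (N_position move_h p <-> ~ A_h h p)).
{ apply kernel_positions.
  - apply well_founded_move_h.
  - intros p; unfold A_h; lia.
  - intros p q; now apply nim_sum_zero_move.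
  - intros p; now apply nim_sum_nonzero_move. }
split; intros p; apply H.
Qed.
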